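(* The commuting conjugacy class graph of each of the following groups is not CN-hyperenergetic: (1) the dihedral group $D_{2m}$ of order $2m$, where $m\ge 3$; (2) the group $T_{4n}=\langle x,y : x^{2n}=1,\ x^n=y^2,\ y^{-1}xy=x^{-1}\rangle$, where $n\ge 2$; (3) the group $U_{6n}=\langle x,y : x^{2n}=y^3=1,\ x^{-1}yx=y^{-1}\rangle$, where $n\ge 1$.
   Context: For a finite non-abelian group $G$, the commuting conjugacy class graph $\Gamma(G)$ is the simple undirected graph whose vertices are the conjugacy classes of the non-central elements of $G$; two distinct vertices $a^G$ and $b^G$ are adjacent if there exist $a'\in a^G$, $b'\in b^G$ with $a'b'=b'a'$. For a finite simple graph $\mathcal{G}$ with vertices $v_1,\dots,v_N$, the common neighbourhood matrix $CN(\mathcal{G})$ is the $N\times N$ matrix whose $(i,j)$ entry is, for $i\ne j$, the number of vertices other than $v_i,v_j$ adjacent to both $v_i$ and $v_j$, and is $0$ for $i=j$. The CN-energy $E_{CN}(\mathcal{G})$ is the sum of the absolute values of the eigenvalues of $CN(\mathcal{G})$, counted with multiplicity. With $K_N$ the complete graph on $N=|V(\mathcal{G})|$ vertices, $\mathcal{G}$ is CN-hyperenergetic if $E_{CN}(\mathcal{G})>E_{CN}(K_N)$. *)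

(* Defs.v *)
From HB Require Import structures.
From mathcomp Require Import all_boot all_order all_algebra.
From mathcomp Require Import all_fingroup all_solvable all_field.

Set Implicit Arguments.
Unset Strict Implicit.
Unset Printing Implicit Defensive.

Import Order.TTheory GRing.Theory Num.Theory.

Record sgraph := SGraph {
  vertex :> finType;
  adj : rel vertex;
  adj_sym : symmetric adj;
  adj_irr : irreflexive adj
}.

Lemma complete_adj_sym n : symmetric (fun i j : 'I_n => i != j).
Proof. by move=> i j; rewrite eq_sym. Qed.

Lemma complete_adj_irr n : irreflexive (fun i j : 'I_n => i != j).
Proof. by move=> i; rewrite eqxx. Qed.

Definition complete_graph n : sgraph :=
  SGraph (@complete_adj_sym n) (@complete_adj_irr n).

Section CommonNeighbourhood.
Local Open Scope ring_scope.

Definition common_neighbours (Gr : sgraph) (u v : Gr) : {set Gr} :=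
  [set w : Gr | [&& w != u, w != v, adj w u & adj w v]].

(* Vertices are numbered by [enum_val]; entries are taken in [algC], where the
   characteristic polynomial splits. *)
Definition cn_matrix (Gr : sgraph) : 'M[algC]_#|Gr| :=
  \matrix_(i, j)
    if i == j then 0
    else #|common_neighbours (enum_val i : Gr) (enum_val j : Gr)|%:R.

(* The list of roots of the characteristic polynomial, each repeated according
   to its multiplicity. *)
Definition eigenvalues n (A : 'M[algC]_n) : seq algC :=
  sval (closed_field_poly_normal (char_poly A)).

Definition cn_energy (Gr : sgraph) : algC :=
  \sum_(z <- eigenvalues (cn_matrix Gr)) `|z|.

Definition cn_hyperenergetic (Gr : sgraph) : bool :=
  cn_energy (complete_graph #|Gr|) < cn_energy Gr.

End CommonNeighbourhood.

Section CommutingConjugacyClassGraph.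
Local Open Scope group_scope.
Variables (gT : finGroupType) (G : {group gT}).

Definition noncentral_classes : {set {set gT}} :=
  [set x ^: G | x in G :\: 'Z(G)].

Definition noncentral_class : finType :=
  {C : {set gT} | C \in noncentral_classes}.

Definition ccc_adj : rel noncentral_class := fun C D =>
  (C != D) && [exists a in val C, exists b in val D, a * b == b * a].

Lemma ccc_adj_sym : symmetric ccc_adj.
Proof.
suff H C D : ccc_adj C D -> ccc_adj D C by move=> C D; apply/idP/idP; apply: H.
case/andP=> nCD /exists_inP[a Ca] /exists_inP[b Db] /eqP ab.
rewrite /ccc_adj eq_sym nCD; apply/exists_inP; exists b => //.
by apply/exists_inP; exists a => //; rewrite ab.
Qed.

Lemma ccc_adj_irr : irreflexive ccc_adj.
Proof. by move=> C; rewrite /ccc_adj eqxx. Qed.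

Definition ccc_graph : sgraph := SGraph ccc_adj_sym ccc_adj_irr.

End CommutingConjugacyClassGraph.

(* Main.v *)
Require Import Defs.
From mathcomp Require Import all_boot all_order all_algebra.
From mathcomp Require Import all_fingroup all_solvable all_field.

(** Each of the three groups has an abelian subgroup [A] of index at most 2:
    the cyclic group [<[x]>] for the dihedral groups and for [T_{4n}], the
    group generated by [x ^+ 2] and [y] for [U_{6n}].  This alone settles the
    question.

    Group theory: if [A] is abelian of index at most 2 in [G], then the
    centraliser in [G] of every non-central element is abelian
    ([abelian_index_le2_ac]).  In a group with that property, two elements that
    commute with a common non-central element commute with each other; since
    commuting pairs may be conjugated, adjacent-or-equal is then an equivalence
    relation on the non-central classes ([ac_group_cluster]): the commuting
    conjugacy class graph is a disjoint union of cliques.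

    Spectral theory: let the graph [Gr] be a disjoint union of cliques, with [N]
    vertices, and let subtraction be truncated at 0 in [k - 2] and [N - 2].  On
    a clique of size [k] the common neighbourhood matrix is [k - 2] times
    (all-ones minus identity), so its eigenvalues there are among
    [- (k - 2)] and [(k - 2) * (k - 1)] ([cluster_eigenvalue]).  All eigenvalues
    are thus real and at least [- (N - 2)], and their sum, the trace, is 0.  For
    such a family the sum of the absolute values equals the sum of the
    [`|z| - z], where each term is at most [2 * (N - 2)] and some term vanishes
    because not all eigenvalues are negative.  Hence the CN-energy is at most
    [2 * (N - 2) * (N - 1)].  For the complete graph there are only the two
    values [- (N - 2)] and [(N - 2) * (N - 1)]; if they are distinct, zero trace
    forces the second one to occur exactly once, so that the bound is attained.
    Comparing gives [cluster_not_cn_hyperenergetic]. *)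

Set Implicit Arguments.
Unset Strict Implicit.
Unset Printing Implicit Defensive.

Import Order.TTheory GRing.Theory Num.Theory.

(** * The eigenvalue list of a complex matrix *)

Section Spectrum.
Local Open Scope ring_scope.
Variables (n : nat) (A : 'M[algC]_n).

Let char_polyE : char_poly A = \prod_(z <- eigenvalues A) ('X - z%:P).
Proof.
rewrite /eigenvalues; case: closed_field_poly_normal => r /= ->.
by rewrite (monicP (char_poly_monic A)) scale1r.
Qed.

Lemma mem_eigenvalues z : (z \in eigenvalues A) = eigenvalue A z.
Proof. by rewrite eigenvalue_root_char char_polyE root_prod_XsubC. Qed.

Lemma size_eigenvalues : size (eigenvalues A) = n.
Proof.
by apply: succn_inj; rewrite -(size_char_poly A) char_polyE size_prod_XsubC.
Qed.

Lemma sum_eigenvalues : \sum_(z <- eigenvalues A) z = \tr A.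
Proof.
have [n0|n_gt0] := posnP n.
  have /nilP-> : nilp (eigenvalues A) by rewrite /nilp size_eigenvalues n0.
  rewrite big_nil /mxtrace big1 // => i _.
  by have := ltn_ord i; rewrite [X in (_ < X)%N]n0.
apply: oppr_inj; rewrite -char_poly_trace // char_polyE.
by rewrite -coefPn_prod_XsubC size_eigenvalues // -lt0n.
Qed.

End Spectrum.

(** * Absolute sums of zero-sum families *)

Section SumConstant.
Local Open Scope ring_scope.

Lemma sumr_const_seq (V : nmodType) (I : Type) (s : seq I) (x : V) :
  \sum_(i <- s) x = x *+ size s.
Proof. by rewrite big_const_seq iter_addr_0 count_predT. Qed.

Lemma sumr_const_count (V : nmodType) (I : Type) (P : pred I) (s : seq I)
    (x : V) :
  \sum_(i <- s) x *+ P i = x *+ count P s.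
Proof. by rewrite sumrMnr -sum1_count [in RHS]big_mkcond. Qed.

End SumConstant.

Section ZeroSumFamilies.
Local Open Scope ring_scope.
Variables (R : numDomainType) (c : R) (s : seq R).
Hypotheses (c_ge0 : 0 <= c) (sum0 : \sum_(z <- s) z = 0).

(** The terms on the right vanish at every [z >= 0], so only the negative
    members of the family have to be controlled. *)
Lemma sum_norm_zero_sum : \sum_(z <- s) `|z| = \sum_(z <- s) (`|z| - z).
Proof. by rewrite sumrB sum0 subr0. Qed.

(** Every term [`|z| - z] is at most [2 * c], and one of them is 0: if all
    members were negative, so would be their sum. *)
Lemma sum_norm_le_of_lower_bound :
    {in s, forall z, - c <= z} -> s != [::] ->
  \sum_(z <- s) `|z| <= c *+ 2 *+ (size s).-1.
Proof.
move=> lb s_neq0.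
(* In a partially ordered domain, comparability with the real [- c] is what
   makes the members real. *)
have sreal : {in s, forall z, z \is Num.real}.
  by move=> z /lb/ler_real <-; rewrite rpredN ger0_real.
have term z : z \in s -> `|z| - z <= c *+ 2.
  move=> sz; have := lb z sz; case: (real_ge0P (sreal z sz)) => [z_ge0 _|_ lbz].
    by rewrite subrr mulrn_wge0.
  by rewrite -opprD -mulr2n -mulNrn lerMn2r lerNl.
have /hasP[z0 sz0 z0_ge0] : has (fun z => 0 <= z) s.
  apply: contraT => /hasPn neg.
  have neg' z : z \in s -> z < 0.
    by move=> sz; rewrite real_ltNge ?real0 ?sreal ?neg.
  case: s s_neq0 sum0 neg' => // z t _; rewrite big_cons => sumzt neg'.
  have: z + \sum_(y <- t) y < 0.
    rewrite -[ltRHS]addr0 ltr_leD ?neg' ?mem_head //.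
    by rewrite big_seq sumr_le0 // => y ty; rewrite ltW ?neg' ?in_cons ?ty ?orbT.
  by rewrite sumzt ltxx.
rewrite sum_norm_zero_sum (big_rem z0) //= ger0_norm // subrr add0r.
rewrite -(size_rem sz0) -sumr_const_seq big_seq [leRHS]big_seq.
by apply: ler_sum => z /mem_rem; apply: term.
Qed.

(** An equality case of [sum_norm_le_of_lower_bound].  Both sides are 0 when
    [c = 0].  Otherwise the two values differ by [c * N], so if [p] members take
    the larger one, the sum is [c * N * (p - 1)]; as it is 0, [p = 1], and the
    [N - 1] other members contribute [2 * c] each. *)
Lemma sum_norm_of_two_values (N := size s) :
    {in s, forall z, z = - c \/ z = c * (N%:R - 1)} -> (0 < N)%N ->
  \sum_(z <- s) `|z| = c *+ 2 *+ N.-1.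
Proof.
move=> two N_gt0; have [c0|c_neq0] := eqVneq c 0.
  rewrite c0 !mul0rn big_seq big1 // => z /two.
  by rewrite c0 oppr0 mul0r => -[] ->; rewrite normr0.
have N1_ge0 : 0 <= N%:R - 1 :> R by rewrite subr_ge0 ler1n.
have neq z : z \in s -> z = - c + (c * N%:R) *+ (z != - c).
  case/two=> ->; first by rewrite eqxx addr0.
  have -> : c * (N%:R - 1) = - c + c * N%:R by rewrite mulrBr mulr1 addrC.
  rewrite -subr_eq0 opprK addrAC addNr add0r mulf_eq0 (negPf c_neq0) pnatr_eq0.
  by rewrite -lt0n N_gt0.
pose p := count (fun z => z != - c) s.
have p1 : p = 1%N.
  have: \sum_(z <- s) z = - c *+ N + (c * N%:R) *+ p.
    rewrite big_seq (eq_bigr _ neq) -big_seq big_split /= sumr_const_seq.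
    by rewrite -[p]/(count _ _) -sumr_const_count.
  rewrite sum0 => /esym/eqP; rewrite -[- c *+ N]mulr_natr mulNr addrC.
  rewrite -[_ *+ p]mulr_natr subr_eq0 -[X in _ == X]mulr1.
  have cN : c * N%:R != 0 by rewrite mulf_neq0 // pnatr_eq0 -lt0n.
  by move/eqP/(mulfI cN)/eqP; rewrite -[1]/(1%:R) eqr_nat => /eqP.
have term z : z \in s -> `|z| - z = c *+ 2 *+ (z == - c).
  have [-> _|zc /two[/eqP|->]] := eqVneq z (- c).
  - by rewrite normrN opprK ger0_norm // -mulr2n.
  - by rewrite (negPf zc).
  by rewrite ger0_norm ?mulr_ge0 // subrr.
rewrite sum_norm_zero_sum big_seq (eq_bigr _ term) -big_seq.
rewrite (sumr_const_count (pred1 (- c))); congr (_ *+ _).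
have := count_predC (pred1 (- c)) s.
by rewrite -[count (predC _) s]/p p1 addn1 /N => <-.
Qed.

End ZeroSumFamilies.

(** * Common neighbourhoods in disjoint unions of cliques *)

Definition closed_nbhd (Gr : sgraph) (u : Gr) : {set Gr} :=
  [set w | (w == u) || adj w u].

(** Disjoint unions of cliques: adjacent-or-equal is always reflexive and
    symmetric, so that transitivity makes it an equivalence relation, whose
    classes are the cliques. *)
Definition cluster_graph (Gr : sgraph) : Prop :=
  transitive (fun u v : Gr => (u == v) || adj u v).

Lemma complete_cluster n : cluster_graph (complete_graph n).
Proof. by move=> v u w _ _ /=; rewrite orbN. Qed.

Section ClusterGraph.
Local Open Scope ring_scope.
Variable Gr : sgraph.
Hypothesis cl : cluster_graph Gr.

Lemma closed_nbhd_id (u v : Gr) : u \in closed_nbhd v ->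
  closed_nbhd u = closed_nbhd v.
Proof.
rewrite inE => uv; apply/setP=> w; rewrite !inE.
apply/idP/idP=> [wu|wv]; first exact: cl wu uv.
by apply: cl wv _; rewrite eq_sym adj_sym.
Qed.

(** In a clique all the other vertices are common neighbours of [u] and [v],
    while vertices of different cliques have none. *)
Lemma card_common_neighbours (u v : Gr) : u != v ->
  #|common_neighbours u v|
    = if u \in closed_nbhd v then (#|closed_nbhd v| - 2)%N else 0%N.
Proof.
move=> uv; case: ifPn => [Kuv|nKuv]; last first.
  apply: eq_card0 => w; rewrite !inE; apply: contraNF nKuv.
  case/and4P=> _ _ wu wv; rewrite inE; apply: (cl (y := w)).
    by rewrite adj_sym wu orbT.
  by rewrite wv orbT.
have -> : common_neighbours u v = closed_nbhd v :\ u :\ v.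
  apply/setP=> w; rewrite !inE; case: (eqVneq w v) => [->|wv] /=.
    by rewrite !andbF.
  case: (eqVneq w u) => //= wu; have := closed_nbhd_id Kuv.
  by move/setP/(_ w); rewrite !inE (negPf wu) (negPf wv) /= => ->; rewrite andbb.
rewrite [in RHS](cardsD1 u) Kuv [in RHS](cardsD1 v) !inE eqxx eq_sym uv /=.
by rewrite addnA addKn.
Qed.

(** Let [f] be an eigenvector.  At a vertex [u] of a clique of size [k], with
    [c = k - 2], the eigenvalue equation reads [(a + c) * f u = c * S], where [S]
    is the sum of [f] over the clique.  Take [u] with [f u != 0].  If [a + c] is
    nonzero, then [f] is constant on the clique, whence [S = k * f u] and
    [a = c * (k - 1)].  The subtraction in [k - 2] is truncated: when [k = 1]
    both alternatives say that [a = 0]. *)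
Lemma cluster_eigenvalue a : eigenvalue (cn_matrix Gr) a ->
  exists u : Gr, let k := #|closed_nbhd u| in
    a = - (k - 2)%:R \/ a = (k - 2)%:R * (k%:R - 1).
Proof.
case/eigenvalueP=> x eig /rV0Pn[j xj].
pose f (u : Gr) := x 0 (enum_rank u).
pose c (u : Gr) : algC := (#|closed_nbhd u| - 2)%:R.
pose S (u : Gr) := \sum_(w in closed_nbhd u) f w.
(* The diagonal entry of the matrix is 0 instead of [c u]; moving [c u * f u] to
   the left completes the sum over the closed neighbourhood. *)
have eq_at u : (a + c u) * f u = c u * S u.
  have /rowP/(_ (enum_rank u)) := eig; rewrite !mxE => eig_u.
  rewrite mulrDl -eig_u (reindex_onto enum_rank enum_val) /=; last first.
    by move=> i _; rewrite enum_valK.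
  rewrite (eq_bigl predT); last by move=> w; rewrite enum_rankK eqxx.
  rewrite (bigD1 u) //= !mxE eqxx mulr0 add0r.
  rewrite /S [in RHS](bigD1 u) ?inE ?eqxx //= mulrDr addrC; congr (_ + _).
  rewrite mulr_sumr [RHS]big_mkcondl /=; apply: eq_bigr => w wu.
  rewrite !mxE (inj_eq enum_rank_inj) (negPf wu) !enum_rankK.
  by rewrite card_common_neighbours //; case: ifP; rewrite ?mulr0 // mulrC.
have fu : f (enum_val j) != 0 by rewrite /f enum_valK.
move: {xj} (enum_val j) fu => u fu; exists u => k; rewrite -/(c u).
have [/eqP|ac] := eqVneq (a + c u) 0; first by rewrite addr_eq0 => /eqP; left.
right; have constf w : w \in closed_nbhd u -> f w = f u.
  move=> /closed_nbhd_id wu; apply: (mulfI ac); rewrite eq_at.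
  by have := eq_at w; rewrite /S /c wu.
have := eq_at u; rewrite /S (eq_bigr _ constf) sumr_const.
rewrite -[f u *+ _]mulr_natr mulrCA [RHS]mulrC => /(mulIf fu); rewrite -/k => h.
by rewrite mulrBr mulr1 -h addrK.
Qed.

End ClusterGraph.

(** * CN-energy of disjoint unions of cliques *)

Section CNEnergy.
Local Open Scope ring_scope.

Lemma sum_cn_eigenvalues (Gr : sgraph) :
  \sum_(z <- eigenvalues (cn_matrix Gr)) z = 0.
Proof.
by rewrite sum_eigenvalues /mxtrace big1 // => i _; rewrite mxE eqxx.
Qed.

Lemma cn_energy_complete n : (0 < n)%N ->
  cn_energy (complete_graph n) = (n - 2)%:R *+ 2 *+ n.-1.
Proof.
move=> n_gt0; pose K := complete_graph n.
have cardK : #|K| = n by rewrite card_ord.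
have szK : size (eigenvalues (cn_matrix K)) = n by rewrite size_eigenvalues.
rewrite /cn_energy -[in RHS]szK [X in (X - 2)%N]szK.
apply: sum_norm_of_two_values; rewrite ?ler0n ?sum_cn_eigenvalues ?szK //.
move=> z; rewrite mem_eigenvalues => /(cluster_eigenvalue (@complete_cluster n)).
case=> u; have -> : closed_nbhd u = [set: K].
  by apply/setP=> w; rewrite !inE orbN.
by rewrite cardsT cardK.
Qed.

Lemma cluster_cn_energy_le (Gr : sgraph) : cluster_graph Gr -> (0 < #|Gr|)%N ->
  cn_energy Gr <= (#|Gr| - 2)%:R *+ 2 *+ #|Gr|.-1.
Proof.
move=> cl Gr_gt0; have sz := size_eigenvalues (cn_matrix Gr).
rewrite /cn_energy -[in X in _ *+ X]sz.
apply: sum_norm_le_of_lower_bound; rewrite ?ler0n ?sum_cn_eigenvalues //;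
  last by rewrite -size_eq0 sz -lt0n.
move=> z; rewrite mem_eigenvalues => /(cluster_eigenvalue cl)[u] /=.
have ku : (#|closed_nbhd u| <= #|Gr|)%N by rewrite max_card.
have k_gt0 : (0 < #|closed_nbhd u|)%N.
  by apply/card_gt0P; exists u; rewrite !inE eqxx.
case=> ->; first by rewrite lerN2 ler_nat leq_sub2r.
rewrite (@le_trans _ _ 0) ?oppr_le0 ?ler0n // mulr_ge0 ?ler0n //.
by rewrite subr_ge0 ler1n.
Qed.

Theorem cluster_not_cn_hyperenergetic (Gr : sgraph) :
  cluster_graph Gr -> ~~ cn_hyperenergetic Gr.
Proof.
move=> cl; rewrite /cn_hyperenergetic; have [Gr0|Gr_gt0] := posnP #|Gr|.
  rewrite /cn_energy [X in _ < X]big1_seq ?le_gtF ?sumr_ge0 // => z.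
  case/andP=> _; have: nilp (eigenvalues (cn_matrix Gr)).
    by rewrite /nilp size_eigenvalues Gr0.
  by move/nilP->.
by rewrite cn_energy_complete // le_gtF ?cluster_cn_energy_le.
Qed.

End CNEnergy.

(** * Groups with an abelian subgroup of index at most two *)

Section AbelianIndexTwo.
Local Open Scope group_scope.
Variable gT : finGroupType.
Implicit Types G A : {group gT}.

Lemma noncentral_class_subset G (X : ccc_graph G) : val X \subset G.
Proof.
have /imsetP[x /setDP[Gx _] ->] := valP X.
by rewrite class_subG.
Qed.

Lemma noncentral_class_transl G (X : ccc_graph G) (a x : gT) :
  a \in val X -> x \in val X -> exists2 g, g \in G & x = a ^ g.
Proof.
have /imsetP[x0 _ ->] := valP X.
by move=> /class_eqP <- /imsetP[g Gg ->]; exists g.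
Qed.

(** A commuting pair of representatives can be conjugated so that the first one
    is any prescribed element of its class. *)
Lemma ccc_adj_commute G (X Y : ccc_graph G) : (X == Y) || adj X Y ->
  forall x, x \in val X -> exists2 y, y \in val Y & commute x y.
Proof.
case/orP=> [/eqP<- x Xx|]; first by exists x.
case/andP=> _ /exists_inP[a Xa] /exists_inP[b Yb] /eqP ab x Xx.
have [g Gg ->] := noncentral_class_transl Xa Xx.
exists (b ^ g); last by rewrite /commute -!conjMg ab.
have /imsetP[y0 /setDP[Gy0 _] defY] := valP Y.
by move: Yb; rewrite defY => /class_eqP <-; apply: memJ_class.
Qed.

(** If the class of [y] is adjacent to two others, these have representatives
    that commute with the same [y]; both lie in the abelian group ['C_G[y]], so
    they commute with each other. *)
Lemma ac_group_cluster G :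
  {in G :\: 'Z(G), forall b, abelian 'C_G[b]} -> cluster_graph (ccc_graph G).
Proof.
move=> AC Y X Z XY YZ.
have /imsetP[y ncy defY] := valP Y.
have Yy : y \in val Y by rewrite defY class_refl.
have YX : (Y == X) || adj Y X by rewrite eq_sym adj_sym.
have [x Xx yx] := ccc_adj_commute YX Yy.
have [z Zz yz] := ccc_adj_commute YZ Yy.
have Cx : x \in 'C_G[y].
  by rewrite inE (subsetP (noncentral_class_subset X)) //; apply/cent1P.
have Cz : z \in 'C_G[y].
  by rewrite inE (subsetP (noncentral_class_subset Z)) //; apply/cent1P.
case: eqVneq => //= XneqZ; rewrite /ccc_adj XneqZ.
apply/exists_inP; exists x => //; apply/exists_inP; exists z => //.
by apply/eqP; apply: (centsP (AC y ncy)).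
Qed.

Lemma index_le2_divr G A x y : A \subset G -> #|G : A| <= 2 ->
  x \in G :\: A -> y \in G :\: A -> x * y^-1 \in A.
Proof.
move=> sAG iA Gx Gy; rewrite -mem_rcoset.
have one : #|rcosets A G :\ (A : {set gT})| <= 1.
  have AA : (A : {set gT}) \in rcosets A G.
    by apply/rcosetsP; exists 1; rewrite ?rcoset1.
  by move: iA; rewrite /indexg (cardsD1 (A : {set gT})) AA.
have mem z : z \in G :\: A -> A :* z \in rcosets A G :\ (A : {set gT}).
  case/setDP=> Gz nAz; rewrite !inE mem_rcosets mulSGid // Gz andbT.
  by apply: contraNneq nAz => <-; apply: rcoset_refl.
rewrite (card_le1_eqP one _ _ (mem x Gx) (mem y Gy)); apply: rcoset_refl.
Qed.

(** An element of [A] that commutes with a single element outside [A] is central,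
    because [A] and that element together give all of [G].  So if [b] is in
    [A] and not central, its centraliser stays inside [A]; if [b] is outside [A],
    then every element of its centraliser is central, or is [b] times a central
    element. *)
Lemma abelian_index_le2_ac G A : A \subset G -> abelian A -> #|G : A| <= 2 ->
  {in G :\: 'Z(G), forall b, abelian 'C_G[b]}.
Proof.
move=> sAG cAA iA b /setDP[Gb nZb].
have cA u v : u \in A -> v \in A -> commute u v.
  by move=> Au Av; apply: (centsP cAA).
have divA u v :
    u \in G -> v \in G -> u \notin A -> v \notin A -> u * v^-1 \in A.
  by move=> Gu Gv nAu nAv; apply: (index_le2_divr sAG iA); apply/setDP.
have spread a w : a \in A -> w \in G -> w \notin A -> commute a w ->
    forall v, v \in G -> commute a v.
  move=> Aa Gw nAw aw v Gv; have [Av|nAv] := boolP (v \in A); first exact: cA.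
  by rewrite -(mulgKV w v); apply: commuteM => //; apply/cA/divA.
have central a : a \in G -> (forall v, v \in G -> commute a v) -> a \in 'Z(G).
  by move=> Ga ca; apply/centerP.
have [Ab|nAb] := boolP (b \in A).
  apply: (abelianS _ cAA); apply/subsetP=> w /setIP[Gw /cent1P bw].
  by apply: contraR nZb => nAw; apply: central => //; apply: (spread b w).
apply/centsP=> u /setIP[Gu /cent1P bu] v /setIP[Gv /cent1P bv].
have [Au|nAu] := boolP (u \in A).
  by apply: (spread u b) => //; apply: commute_sym.
(* Here [u * b^-1] lies in [A] and commutes with [b], so it is central. *)
rewrite -(mulgKV b u); apply/commute_sym/commuteM; last exact: commute_sym.
apply/commute_sym; apply: (spread _ b) => //; first exact: divA.
by apply/commute_sym/commuteM; [apply: commute_sym|apply: commuteV].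
Qed.

Lemma cycle_join_index_le2 A (g : gT) : g \in 'N(A) -> g ^+ 2 \in A ->
  #|A <*> <[g]> : A| <= 2.
Proof.
move=> nAg g2; rewrite norm_joinEr ?cycle_subG //.
suffices sub : rcosets A (A * <[g]>) \subset [set (A : {set gT}); A :* g].
  by rewrite (leq_trans (subset_leq_card sub)) // cards2; case: eqP.
apply/subsetP=> _ /rcosetsP[_ /mulsgP[a _ Aa /cycleP[k ->] ->] ->].
have g2k : g ^+ (2 * k./2) \in A by rewrite expgM groupX.
rewrite rcosetM (rcoset_id Aa) -(odd_double_half k) addnC -mul2n expgD.
rewrite rcosetM (rcoset_id g2k) !inE.
by case: (odd k); rewrite ?expg1 ?expg0 ?rcoset1 eqxx ?orbT.
Qed.

Lemma cycle_join_not_cn_hyperenergetic G A (g : gT) :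
    abelian A -> g \in 'N(A) -> g ^+ 2 \in A -> A <*> <[g]> = G ->
  ~~ cn_hyperenergetic (ccc_graph G).
Proof.
move=> cAA nAg g2 defG.
apply/cluster_not_cn_hyperenergetic/ac_group_cluster.
apply: (abelian_index_le2_ac _ cAA); first by rewrite -defG joing_subl.
by rewrite -defG cycle_join_index_le2.
Qed.

(** With [A := <[x]>] this covers both the dihedral groups and [T_{4n}], which
    differ only in the value of [y ^+ 2]. *)
Lemma invert_cycle_not_cn_hyperenergetic G (x y : gT) :
    <[x]> <*> <[y]> = G -> x ^ y = x^-1 -> y ^+ 2 \in <[x]> ->
  ~~ cn_hyperenergetic (ccc_graph G).
Proof.
move=> defG xy y2; apply: (cycle_join_not_cn_hyperenergetic _ _ y2 defG).
  exact: cycle_abelian.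
by rewrite -cycle_subG norms_cycle xy groupV cycle_id.
Qed.

(** Conjugating twice by [x] fixes [y], so [x ^+ 2] and [y] generate an abelian
    group; [x] normalises it, and its square lies in it. *)
Lemma invert_conj_not_cn_hyperenergetic G (x y : gT) :
    <[x]> <*> <[y]> = G -> y ^ x = y^-1 -> ~~ cn_hyperenergetic (ccc_graph G).
Proof.
move=> defG yx.
have x2y : commute (x ^+ 2) y.
  apply/commute_sym/commgP/conjg_fixP.
  by rewrite expgS expg1 conjgM yx conjVg yx invgK.
apply: (@cycle_join_not_cn_hyperenergetic _ (<[x ^+ 2]> <*> <[y]>)%G x).
- by rewrite abelianY !cycle_abelian cent_cycle cycle_subG; apply/cent1P.
- rewrite -cycle_subG normsY // norms_cycle ?yx ?groupV ?cycle_id //.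
  by rewrite conjXg conjgE mulKg cycle_id.
- by rewrite mem_gen // inE cycle_id.
by rewrite /= joingC joingA (joing_idPl (cycleX x 2)).
Qed.

End AbelianIndexTwo.

Local Open Scope group_scope.

Theorem corollary3p7 :
  (forall (m : nat), (3 <= m)%N ->
     forall (gT : finGroupType) (G : {group gT}),
       G \isog 'D_(2 * m)%N -> ~ cn_hyperenergetic (ccc_graph G))
  /\
  (forall (n : nat), (2 <= n)%N ->
     forall (gT : finGroupType) (G : {group gT}),
       G \isog Grp (x : y : x ^+ (2 * n)%N = 1, x ^+ n = y ^+ 2,
                            y^-1 * x * y = x^-1) ->
       ~ cn_hyperenergetic (ccc_graph G))
  /\
  (forall (n : nat), (1 <= n)%N ->
     forall (gT : finGroupType) (G : {group gT}),
       G \isog Grp (x : y : x ^+ (2 * n)%N = y ^+ 3 = 1,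
                            x^-1 * y * x = y^-1) ->
       ~ cn_hyperenergetic (ccc_graph G)).
Proof.
split; [|split] => [m m_ge3|n _|n _] gT G.
- have m_gt1 : 1 < m by apply: leq_trans m_ge3.
  rewrite mul2n => isoG.
  have := isoGrp_hom (isoGrp_trans isoG (Grp_dihedral m_gt1)).
  case/existsP=> -[x y] /= /eqP[defG _ y2 xy].
  by apply/negP/(invert_cycle_not_cn_hyperenergetic defG xy); rewrite y2 group1.
- case/isoGrp_hom/existsP=> -[x y] /= /eqP[defG _ xn xy].
  apply/negP/(invert_cycle_not_cn_hyperenergetic defG).
    by rewrite conjgE mulgA.
  by rewrite -xn mem_cycle.
case/isoGrp_hom/existsP=> -[x y] /= /eqP[defG _ _ yx].
by apply/negP/(invert_conj_not_cn_hyperenergetic defG); rewrite conjgE mulgA.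
Qed.
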